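(* Let $1\le p<\infty$ and let $w=\{w_n\}_{n\in\mathbb{Z}}$ be a bounded sequence of positive real numbers such that the limits $\lim_{n\to\infty}w_n=w_+$ and $\lim_{n\to\infty}w_{-n}=w_-$ exist. Let $F_w$ and $B_w$ be the bilateral weighted forward shift and the bilateral weighted backward shift, respectively, on $\ell^p(\mathbb{Z})$. Then the following hold (with $\lambda$ ranging over $\mathbb{C}$). (1) If $w_+\le w_-$, then $\{\lambda: w_+<|\lambda|<w_-\}\subseteq\sigma_p(F_w)\subseteq\{\lambda: w_+\le|\lambda|\le w_-\}$. (2) If $w_-<w_+$, then $\sigma_p(F_w)=\emptyset$. (3) If $w_-\le w_+$, then $\{\lambda: w_-<|\lambda|<w_+\}\subseteq\sigma_p(B_w)\subseteq\{\lambda: w_-\le|\lambda|\le w_+\}$. (4) If $w_+<w_-$, then $\sigma_p(B_w)=\emptyset$.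
   Context: $\ell^p(\mathbb{Z})$ is the complex Banach space of $p$-summable families indexed by $\mathbb{Z}$. The bilateral weighted shifts with weights $w$ are the bounded operators $F_w(\{x_n\}_{n\in\mathbb{Z}})=\{w_{n-1}x_{n-1}\}_{n\in\mathbb{Z}}$ and $B_w(\{x_n\}_{n\in\mathbb{Z}})=\{w_{n+1}x_{n+1}\}_{n\in\mathbb{Z}}$. The point spectrum $\sigma_p(T)$ of a bounded operator $T$ is the set of all $\lambda\in\mathbb{C}$ such that $T-\lambda I$ is not injective, i.e. the set of eigenvalues of $T$. *)

(* Defs.v *)
From HB Require Import structures.
From mathcomp Require Import all_boot all_order all_algebra.
From mathcomp Require Import complex ring.
From mathcomp Require Import all_classical all_reals all_analysis.

Set Implicit Arguments.
Unset Strict Implicit.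
Unset Printing Implicit Defensive.

Import Order.TTheory GRing.Theory Num.Theory.
Import numFieldTopology.Exports numFieldNormedType.Exports.
Import ComplexField.Normc.

Local Open Scope classical_set_scope.
Local Open Scope ring_scope.
Local Open Scope complex_scope.

Section lp_sum.
Variables (R : realType) (p : R).
Implicit Types (x y : int -> R[i]).

(* [normc z : R] is the modulus of [z : R[i]]; the library norm [`|z|] is the
   same number seen in [R[i]], i.e. [(normc z)%:C]. *)
Definition lp_sum x : \bar R := \esum_(n in [set: int]) (normc (x n) `^ p)%:E.

Definition lp_pred : {pred int -> R[i]} := mem [set x | (lp_sum x < +oo)%E].

Definition lp_norm x : R := fine (lp_sum x) `^ p^-1.

Lemma normc_ge0 (z : R[i]) : 0 <= normc z.
Proof. by case: z => a b; exact: sqrtr_ge0. Qed.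

Lemma normc_real (r : R) : 0 <= r -> normc r%:C = r.
Proof. by move=> r0; rewrite /= expr0n/= addr0 sqrtr_sqr ger0_norm. Qed.

Lemma lp_sum_ge0 x : (0 <= lp_sum x)%E.
Proof. by apply: esum_ge0 => n _; rewrite lee_fin powR_ge0. Qed.

Lemma lp_norm_ge0 x : 0 <= lp_norm x.
Proof. exact: powR_ge0. Qed.

Lemma ge0_esumZl (k : R) (a : int -> \bar R) : 0 <= k ->
    (forall n, 0 <= a n)%E ->
  (\esum_(n in [set: int]) (k%:E * a n) =
   k%:E * \esum_(n in [set: int]) a n)%E.
Proof.
move=> k0 a0; rewrite /esum -ereal_supZl//; last first.
  by apply/set0P; exists 0%E; exists set0; [exact: fsets_set0|rewrite fsbig_set0].
congr (ereal_sup _); apply/seteqP; split=> [_ [X XP <-]|_ [_ [X XP <-] <-]].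
  exists (\sum_(i \in X) a i)%E; first by exists X.
  by rewrite ge0_mule_fsumr.
by exists X => //; rewrite ge0_mule_fsumr.
Qed.

Lemma lp_sum_eq0 x : lp_sum x = 0%E -> 0 < p -> forall n, x n = 0.
Proof.
move=> s0 p0 n; apply: eq0_normc; apply/(powR_eq0_eq0 (p := p)).
apply/EFin_inj/le_anti/andP; split; last by rewrite lee_fin powR_ge0.
suff : ((normc (x n) `^ p)%:E <= lp_sum x)%E by rewrite s0.
apply: esum_ge; exists [set n] => //.
by rewrite fsbig_set1.
Qed.

Hypothesis p1 : 1 <= p.

Let p0 : 0 < p. Proof. exact: lt_le_trans p1. Qed.

Lemma lp_sumE x : x \in lp_pred -> lp_sum x = (lp_norm x `^ p)%:E.
Proof.
rewrite inE/= => xfin; rewrite /lp_norm -powRrM mulVf ?gt_eqF// powRr1.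
  by rewrite fineK// ge0_fin_numE// lp_sum_ge0.
by rewrite fine_ge0// lp_sum_ge0.
Qed.

Lemma lp_sum_le x (r : R) : 0 <= r -> (lp_sum x <= (r `^ p)%:E)%E ->
  x \in lp_pred /\ lp_norm x <= r.
Proof.
move=> r0 xr; have xin : x \in lp_pred.
  by rewrite inE/=; exact: le_lt_trans xr (ltry _).
split=> //; rewrite leNgt; apply/negP => rx.
move: xr; rewrite (lp_sumE xin) lee_fin leNgt => /negP; apply.
by apply: gt0_ltr_powR => //; rewrite nnegrE ?lp_norm_ge0.
Qed.

Lemma lp_norm_eq0 x : x \in lp_pred -> lp_norm x = 0 -> forall n, x n = 0.
Proof.
by move=> xin x0; apply: lp_sum_eq0 p0; rewrite lp_sumE// x0 powR0// gt_eqF.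
Qed.

Lemma lp_sum0 : lp_sum (fun=> 0) = 0%E.
Proof. by rewrite /lp_sum esum1// => n _; rewrite normc0 powR0// gt_eqF. Qed.

Lemma lp_sumM (r : R) x y (s : int -> int) : 0 <= r ->
    (forall n, normc (y n) <= r * normc (x (s n))) -> bijective s ->
  (lp_sum y <= (r `^ p)%:E * lp_sum x)%E.
Proof.
move=> r0 yx sbij; rewrite /lp_sum -ge0_esumZl ?powR_ge0//; last first.
  by move=> n; rewrite lee_fin powR_ge0.
rewrite [leRHS](@reindex_esum _ _ _ [set: int] [set: int] s);
  last by rewrite setTT_bijective.
apply: le_esum => n _; rewrite -EFinM lee_fin -powRM ?normc_ge0//.
apply: ge0_ler_powR; rewrite ?nnegrE ?normc_ge0 ?mulr_ge0 ?normc_ge0//.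
exact: ltW.
Qed.

Lemma lp_normM (r : R) x y (s : int -> int) : 0 <= r ->
    (forall n, normc (y n) <= r * normc (x (s n))) -> bijective s ->
  x \in lp_pred -> y \in lp_pred /\ lp_norm y <= r * lp_norm x.
Proof.
move=> r0 yx sbij xin; apply: lp_sum_le; first by rewrite mulr_ge0 ?lp_norm_ge0.
by rewrite powRM ?lp_norm_ge0// EFinM -lp_sumE//; exact: lp_sumM yx sbij.
Qed.

Lemma convex_powRE (t u v : R) : 0 <= t -> t <= 1 -> 0 <= u -> 0 <= v ->
  (t * u + (1 - t) * v) `^ p <= t * u `^ p + (1 - t) * v `^ p.
Proof.
move=> t0 t1 u0 v0; have := @convex_powR R p p1 (Itv01 t0 t1) u v.
by rewrite !convRE/=; apply; rewrite inE/= in_itv/= andbT.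
Qed.

Lemma lp_normD x y : x \in lp_pred -> y \in lp_pred ->
  (x + y) \in lp_pred /\ lp_norm (x + y) <= lp_norm x + lp_norm y.
Proof.
move=> xin yin; set A := lp_norm x; set B := lp_norm y.
have A0 : 0 <= A := lp_norm_ge0 x.
have B0 : 0 <= B := lp_norm_ge0 y.
have bij_id : bijective (@id int) by exists id.
have sA : lp_sum x = (A `^ p)%:E := lp_sumE xin.
have sB : lp_sum y = (B `^ p)%:E := lp_sumE yin.
have [AE|An0] := eqVneq A 0.
  have x0 := lp_norm_eq0 xin AE.
  have [|] := @lp_normM 1 y (x + y) id ler01 _ bij_id yin.
    by move=> n; rewrite mul1r fctE x0 add0r.
  by rewrite mul1r AE add0r.
have [BE|Bn0] := eqVneq B 0.
  have y0 := lp_norm_eq0 yin BE.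
  have [|] := @lp_normM 1 x (x + y) id ler01 _ bij_id xin.
    by move=> n; rewrite mul1r fctE y0 addr0.
  by rewrite mul1r BE addr0.
clearbody A B.
have Agt0 : 0 < A by rewrite lt0r An0 A0.
have Bgt0 : 0 < B by rewrite lt0r Bn0 B0.
have ABgt0 : 0 < A + B by rewrite addr_gt0.
apply: lp_sum_le; first by rewrite ltW.
pose t := A / (A + B).
have t0 : 0 <= t by rewrite divr_ge0// ltW.
have t1 : t <= 1 by rewrite ler_pdivrMr// mul1r lerDl.
have tE : 1 - t = B / (A + B).
  by rewrite /t -[X in X - _](divff (lt0r_neq0 ABgt0)) -mulrBl addrAC subrr add0r.
have tE' : t = A / (A + B) by [].
clearbody t.
have t1' : 0 <= 1 - t by rewrite subr_ge0.
have AxE : ((A `^ p)^-1%:E * lp_sum x)%E = 1%E.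
  by rewrite (sA, sB) -EFinM mulVf// gt_eqF// powR_gt0.
have ByE : ((B `^ p)^-1%:E * lp_sum y)%E = 1%E.
  by rewrite (sA, sB) -EFinM mulVf// gt_eqF// powR_gt0.
have nn q (z : int -> R[i]) n : (0 <= q)%R -> (0 <= q%:E * (normc (z n) `^ p)%:E)%E.
  by move=> q0; rewrite mule_ge0// lee_fin powR_ge0.
have c1 : 0 <= (A + B) `^ p * (t * (A `^ p)^-1).
  by rewrite mulr_ge0 ?powR_ge0// mulr_ge0// invr_ge0 powR_ge0.
have c2 : 0 <= (A + B) `^ p * ((1 - t) * (B `^ p)^-1).
  by rewrite !mulr_ge0// ?invr_ge0 ?powR_ge0.
apply: (@le_trans _ _ (\esum_(n in [set: int])
   (((A + B) `^ p * (t * (A `^ p)^-1))%:E * (normc (x n) `^ p)%:E +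
    ((A + B) `^ p * ((1 - t) * (B `^ p)^-1))%:E * (normc (y n) `^ p)%:E)%E)).
  apply: le_esum => n _; rewrite -!EFinM -EFinD lee_fin.
  have a0 := normc_ge0 (x n); have b0 := normc_ge0 (y n).
  rewrite -!mulrA -mulrDr.
  have uA0 : 0 <= normc (x n) / A by rewrite divr_ge0.
  have vB0 : 0 <= normc (y n) / B by rewrite divr_ge0.
  set c := t * (normc (x n) / A) + (1 - t) * (normc (y n) / B).
  have c0 : 0 <= c by rewrite addr_ge0// mulr_ge0.
  have xyc : normc ((x + y) n) <= (A + B) * c.
    apply: (le_trans (le_normcD _ _)).
    rewrite /c tE tE' le_eqVlt; apply/orP; left; apply/eqP.
    by field; rewrite !gt_eqF.
  apply: (@le_trans _ _ ((A + B) `^ p * c `^ p)).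
    rewrite -powRM//; last exact: ltW.
    apply: ge0_ler_powR xyc; rewrite ?nnegrE ?normc_ge0 ?mulr_ge0//; exact: ltW.
  rewrite ler_wpM2l ?powR_ge0//; apply: le_trans (convex_powRE _ _ _ _) _ => //.
  have div q r : 0 <= q -> 0 < r -> (q / r) `^ p = (r `^ p)^-1 * q `^ p.
    move=> q0 r0; rewrite powRM ?invr_ge0 ?(ltW r0)// mulrC; congr (_ * _).
    by rewrite -[r^-1]powR_inv1 ?(ltW r0)// powRAC powR_inv1// powR_ge0.
  by rewrite !div.
rewrite esumD; [|by move=> n _; exact: nn|by move=> n _; exact: nn].
rewrite !ge0_esumZl//; [|by move=> n; rewrite lee_fin powR_ge0..].
rewrite !EFinM -!muleA AxE ByE !mule1 -EFinM -EFinM -EFinD -mulrDr.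
by rewrite subrKC mulr1.
Qed.

Lemma lp_submod_closed : submod_closed lp_pred.
Proof.
have bij_id : bijective (@id int) by exists id.
split; first by rewrite inE/= [X in (X < _)%E]lp_sum0.
move=> a x y xin yin; apply: (lp_normD _ yin).1.
by apply: (lp_normM (normc_ge0 a) _ bij_id xin).1 => n; rewrite -normcM.
Qed.

End lp_sum.

Record lpZ (R : realType) (p : R) (p1 : 1 <= p) := LpZ {
  lp_fun :> int -> R[i];
  lp_funP : lp_fun \in lp_pred p }.

Section lpZ_normedModType.
Variables (R : realType) (p : R) (p1 : 1 <= p).
Local Notation V := (lpZ p1).

HB.instance Definition _ := [isSub for @lp_fun R p p1].
HB.instance Definition _ := [Choice of V by <:].
#[local] HB.instance Definition _ :=
  GRing.isSubmodClosed.Build _ _ (lp_pred p) (lp_submod_closed p1).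
HB.instance Definition _ := [SubChoice_isSubLmodule of V by <:].

Lemma lpZ_eqP (x y : V) : x = y <-> x =1 y.
Proof. by split=> [->//|xy]; exact/val_inj/funext. Qed.

Lemma lpZ_addE (x y : V) n : (x + y) n = x n + y n.
Proof. by []. Qed.

Lemma lpZ_scaleE (a : R[i]) (x : V) n : (a *: x) n = a * x n.
Proof. by []. Qed.

Lemma lpZ_subE (x y : V) n : (x - y) n = x n - y n.
Proof. by []. Qed.

Lemma lpZ_0E n : (0 : V) n = 0.
Proof. by []. Qed.

Let nrm (x : V) : R[i] := (lp_norm p x)%:C.

Let nrmD x y : nrm (x + y) <= nrm x + nrm y.
Proof.
by rewrite /nrm -rmorphD/= lecR; apply: (lp_normD p1 (valP x) (valP y)).2.
Qed.

Let bij_id : bijective (@id int). Proof. by exists id. Qed.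

Let le_nrmZ l x : lp_norm p (l *: x : V) <= normc l * lp_norm p x.
Proof.
apply: (lp_normM p1 (normc_ge0 l) _ bij_id (valP x)).2 => n.
by rewrite -normcM.
Qed.

Let nrmZ l x : nrm (l *: x) = `|l| * nrm x.
Proof.
transitivity ((normc l * lp_norm p x)%:C); last by rewrite rmorphM.
rewrite /nrm; congr (_%:C).
apply/le_anti; rewrite le_nrmZ/=.
have [->|l0] := eqVneq l 0; first by rewrite normc0 mul0r lp_norm_ge0.
rewrite -{1}[x](scalerK l0); apply: le_trans (ler_wpM2l (normc_ge0 _) (le_nrmZ _ _)) _.
by rewrite mulrA -normcM mulfV// normc1 mul1r.
Qed.

Let nrm0 x : nrm x = 0 -> x = 0.
Proof.
case=> x0; apply/lpZ_eqP => n.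
exact: (lp_norm_eq0 p1 (valP x) x0).
Qed.

HB.instance Definition _ := Lmodule_isNormed.Build R[i] V nrmD nrmZ nrm0.

Lemma lpZ_normE (x : V) :
  `|x| = (fine (\esum_(n in [set: int]) (normc (x n) `^ p)%:E) `^ p^-1)%:C.
Proof. by []. Qed.

End lpZ_normedModType.

Definition point_spectrum (K : numFieldType) (V : normedModType K)
    (T : {linear V -> V}) : set K :=
  [set l | ~ injective (fun x => T x - l *: x)].

Lemma point_spectrumP (K : numFieldType) (V : normedModType K)
    (T : {linear V -> V}) (l : K) :
  point_spectrum T l <-> exists2 x, x != 0 & T x = l *: x.
Proof.
split=> [ninj|[x x0 Tx] inj]; last first.
  by move/eqP: x0; apply; apply: inj; rewrite Tx linear0 scaler0 !subrr.
apply: contrapT => noeig; apply: ninj => x y Txy.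
apply: contrapT => /eqP xy; apply: noeig.
exists (x - y); first by rewrite subr_eq0.
apply/eqP; rewrite linearB scalerBr subr_eq.
by rewrite -addrA [- _ + _]addrC -Txy addrC subrK.
Qed.

Section shifts.
Variables (R : realType) (p : R) (p1 : 1 <= p) (w : int -> R).
Hypothesis w_bounded : bounded_fun w.
Local Notation V := (lpZ p1).

Lemma bounded_weightP : exists2 M : R, 0 <= M & forall n, `|w n| <= M.
Proof.
have [M Mw] : exists M, \forall n \near globally [set: int], `|w n| <= M.
  by apply/(@ex_bound _ _ _ w _ (@globally_properfilter _ setT (0 : int) I)).
exists M; last by move=> n; exact: Mw.
exact: le_trans (normr_ge0 (w 0)) (Mw 0 I).
Qed.

Let normc_weight (M : R) (z : R[i]) n : (forall k, `|w k| <= M) ->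
  normc ((w n)%:C * z) <= M * normc z.
Proof.
move=> wM; rewrite normcM ler_wpM2r ?normc_ge0//.
by rewrite /= expr0n/= addr0 sqrtr_sqr.
Qed.

Let bij_sub1 : bijective (fun n : int => n - 1).
Proof. by exists (fun n => n + 1) => n; rewrite ?subrK ?addrK. Qed.

Let bij_add1 : bijective (fun n : int => n + 1).
Proof. by exists (fun n => n - 1) => n; rewrite ?subrK ?addrK. Qed.

Lemma forward_shift_subproof (x : V) :
  (fun n => (w (n - 1))%:C * x (n - 1)) \in lp_pred p.
Proof.
have [M M0 wM] := bounded_weightP.
apply: (lp_normM p1 M0 _ bij_sub1 (valP x)).1 => n; exact: normc_weight.
Qed.

Lemma backward_shift_subproof (x : V) :
  (fun n => (w (n + 1))%:C * x (n + 1)) \in lp_pred p.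
Proof.
have [M M0 wM] := bounded_weightP.
apply: (lp_normM p1 M0 _ bij_add1 (valP x)).1 => n; exact: normc_weight.
Qed.

Definition forward_shift (x : V) : V := LpZ p1 (forward_shift_subproof x).

Definition backward_shift (x : V) : V := LpZ p1 (backward_shift_subproof x).

Let forward_shift_linear : linear forward_shift.
Proof. by move=> a x y; apply/lpZ_eqP => n /=; rewrite mulrDr mulrCA. Qed.

Let backward_shift_linear : linear backward_shift.
Proof. by move=> a x y; apply/lpZ_eqP => n /=; rewrite mulrDr mulrCA. Qed.

HB.instance Definition _ :=
  GRing.isLinear.Build R[i] V V *:%R forward_shift forward_shift_linear.

HB.instance Definition _ :=
  GRing.isLinear.Build R[i] V V *:%R backward_shift backward_shift_linear.

Let continuous_le (T : {linear V -> V}) (M : R) :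
  (forall x : V, `|T x| <= M%:C * `|x|) -> continuous T.
Proof.
move=> TM; apply/bounded_linear_continuous/linear_boundedP.
have M_real : M%:C \is Num.real by apply/complex_realP; exists M.
exists M%:C; split=> [//|r Mr x].
by apply: le_trans (TM x) _; rewrite ler_wpM2r// ltW.
Qed.

Lemma forward_shift_continuous : continuous forward_shift.
Proof.
have [M M0 wM] := bounded_weightP; apply: (@continuous_le forward_shift M) => x.
have -> : M%:C * `|x| = (M * lp_norm p x)%:C by rewrite rmorphM.
rewrite lecR.
apply: (lp_normM p1 M0 _ bij_sub1 (valP x)).2 => n; exact: normc_weight.
Qed.

Lemma backward_shift_continuous : continuous backward_shift.
Proof.
have [M M0 wM] := bounded_weightP; apply: (@continuous_le backward_shift M) => x.
have -> : M%:C * `|x| = (M * lp_norm p x)%:C by rewrite rmorphM.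
rewrite lecR.
apply: (lp_normM p1 M0 _ bij_add1 (valP x)).2 => n; exact: normc_weight.
Qed.

End shifts.

Arguments forward_shift {R p} p1 {w} w_bounded x.
Arguments backward_shift {R p} p1 {w} w_bounded x.

(* Main.v *)
Require Import Defs.
From mathcomp Require Import all_boot all_order all_algebra.
From mathcomp Require Import complex zify.
From mathcomp Require Import all_classical all_reals all_analysis.

Import Order.TTheory GRing.Theory Num.Theory.
Import numFieldTopology.Exports numFieldNormedType.Exports.
Import ComplexField.Normc.

Local Open Scope classical_set_scope.
Local Open Scope ring_scope.
Local Open Scope complex_scope.

(** An eigenvector [x] of the forward shift [F] for [l] satisfies the two-sided
    recurrence [w n * x n = l * x (n + 1)].  When [l] is nonzero and all weights
    are nonzero, one coordinate of [x] determines all the others, so up to a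
    scalar there is a single candidate, and [l] is an eigenvalue exactly when
    that candidate is [p]-summable; [l = 0] is never an eigenvalue, because the
    weights are nonzero.

    Summability is read off the successive ratios.  Moving to the right,
    [|x (n + 1)| / |x n| = w n / |l|] tends to [wp / |l|]; moving to the left,
    [|x n| / |x (n + 1)| = |l| / w n] tends to [|l| / wm],
    infinite when [wm = 0].  If [wp < |l| < wm], both limits are below 1 and the ratio test puts the
    candidate in the space ([point_spectrum_forward_shift_gt]).  If [|l| < wp]
    or [wm < |l|], the moduli are eventually nondecreasing along one of the two
    half-lines, without vanishing, which is incompatible with summability
    ([point_spectrum_forward_shift_le]).  So every eigenvalue satisfies
    [wp <= |l| <= wm]; when [wm < wp] there is none.

    The reflection [n |-> - n] of the index set preserves [p]-summability and
    conjugates the backward shift with weights [w n] to the forward shift with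
    weights [w (- n)] ([point_spectrum_backward_shift]).  It exchanges the two
    limits of the weights, so the claims on the backward shift are those on the
    forward shift with [wp] and [wm] swapped. *)

(** * Ratio tests for nonnegative series *)

Lemma ratio_nneseries_lty (R : realType) (b : nat -> R) (r : R) :
  (forall n, 0 <= b n) -> r < 1 ->
  (\forall n \near \oo, b n.+1 <= r * b n) ->
  (\sum_(0 <= n <oo) (b n)%:E < +oo)%E.
Proof.
move=> b0 r1 [N _ bN].
have r1' : 0 < 1 - r by rewrite subr_gt0.
rewrite (nneseries_split 0%N N) => [|k _]; last by rewrite lee_fin.
apply: lte_add_pinfty; first by rewrite sumEFin ltry.
apply: (@le_lt_trans _ _ (b N / (1 - r))%:E); last exact: ltry.
apply: lime_le; first by apply: is_cvg_nneseries => k _ _; rewrite lee_fin.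
exists N => // n /= Nn; rewrite sumEFin lee_fin ler_pdivlMr//.
(* Each term satisfies (1 - r) b_k <= b_k - b_(k+1), and the right-hand sides
   telescope. *)
apply: (@le_trans _ _ (b N - b n)); last by rewrite gerDl oppr_le0.
rewrite mulr_suml -[leRHS]opprB -(telescope_sumr b) // -sumrN.
apply: ler_sum_nat => k /andP[Nk _].
by rewrite opprB mulrBr mulr1 lerD2l lerN2 mulrC; exact: bN.
Qed.

(** From the rank [N] on, the terms stay above [b N > 0], so [m] of them already
    contribute [m * b N]. *)
Lemma nondecreasing_nneseriesy (R : realType) (b : nat -> R) :
  (forall n, 0 < b n) -> (\forall n \near \oo, b n <= b n.+1) ->
  (\sum_(0 <= n <oo) (b n)%:E)%E = +oo%E.
Proof.
move=> b0 [N _ bN]; apply/eqyP => A A0.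
have bge k : b N <= b (N + k)%N.
  elim: k => [|k]; first by rewrite addn0.
  by move/le_trans; rewrite addnS; apply; apply: bN; rewrite /= leq_addr.
pose m := Num.bound (A / b N).
apply: (@le_trans _ _ (\sum_(0 <= n < N + m) (b n)%:E)%E); last first.
  by apply: nneseries_lim_ge => k _ _; rewrite lee_fin ltW.
rewrite sumEFin lee_fin (big_cat_nat _ (n := N)) ?leq_addr//=.
apply: (@le_trans _ _ (\sum_(N <= n < N + m) b n)); last first.
  by rewrite lerDr sumr_ge0// => k _; rewrite ltW.
apply: (@le_trans _ _ (\sum_(N <= n < N + m) b N)).
  rewrite sumr_const_nat addKn -mulr_natl -ler_pdivrMr//.
  by rewrite ltW// archi_boundP// divr_ge0// ltW.
apply: ler_sum_nat => k /andP[Nk _].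
by rewrite -(subnKC Nk); exact: bge.
Qed.

Lemma near_infty_succ (P : nat -> Prop) :
  (\forall n \near \oo, P n) -> \forall n \near \oo, P n.+1.
Proof. by case=> N _ NP; exists N => // n /= Nn; apply: NP; exact: leqW. Qed.

(** * Summability over the integers, one half-line at a time *)

Section two_sided_lp.
Context {R : realType} {p : R}.
Hypothesis p1 : 1 <= p.
Implicit Types (x : int -> R[i]).

Let p0 : 0 < p. Proof. exact: lt_le_trans p1. Qed.

(** The two constructors of [int] cut the index set into half-lines on which the
    one-sided ratio tests apply; [Negz n] is [- n.+1], so that moving away from
    the origin is incrementing [n] on both sides. *)
Lemma lp_sum_int x :
  lp_sum p x = (\sum_(0 <= n <oo) (normc (x (Posz n)) `^ p)%:E +
                \sum_(0 <= n <oo) (normc (x (Negz n)) `^ p)%:E)%E.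
Proof.
have x0 n : (0 <= (normc (x n) `^ p)%:E)%E by rewrite lee_fin powR_ge0.
rewrite /lp_sum (esumID (range Posz))// !setTI.
have -> : ~` range Posz = range Negz.
  apply/seteqP; split=> [[n|n] /= nP|_ [n _ <-] [m _]//].
    by exfalso; apply: nP; exists n.
  by exists n.
by congr (_ + _)%E; rewrite esum_image// ?nneseries_esumT// => m n _ _ [].
Qed.

Lemma lp_pred_ratio x (q q' : R) : q < 1 -> q' < 1 -> 0 <= q -> 0 <= q' ->
  (\forall n \near \oo, normc (x (Posz n.+1)) <= q * normc (x (Posz n))) ->
  (\forall n \near \oo, normc (x (Negz n.+1)) <= q' * normc (x (Negz n))) ->
  x \in lp_pred p.
Proof.
have half (u : nat -> R) r : (forall n, 0 <= u n) -> r < 1 -> 0 <= r ->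
    (\forall n \near \oo, u n.+1 <= r * u n) ->
    (\sum_(0 <= n <oo) (u n `^ p)%:E < +oo)%E.
  move=> u0 r1 r0 ur; apply: (@ratio_nneseries_lty _ _ (r `^ p)).
  - by move=> n; exact: powR_ge0.
  - have <- : 1 `^ p = 1 :> R by rewrite powR1.
    by apply: gt0_ltr_powR => //; rewrite nnegrE.
  apply: filterS ur => n ur; rewrite -powRM//.
  by apply: ge0_ler_powR ur; rewrite ?nnegrE ?mulr_ge0 ?(ltW p0).
move=> q1 q1' q0 q0' xq xq'.
rewrite inE/= lp_sum_int lte_add_pinfty//.
- by apply: half xq => // n; exact: normc_ge0.
- by apply: half xq' => // n; exact: normc_ge0.
Qed.

Let nondecreasing_powR_nneseriesy (u : nat -> R) :
  (forall n, 0 < u n) -> (\forall n \near \oo, u n <= u n.+1) ->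
  (\sum_(0 <= n <oo) (u n `^ p)%:E)%E = +oo%E.
Proof.
move=> u0 ule; apply: nondecreasing_nneseriesy => [n|]; first exact: powR_gt0.
by apply: filterS ule => n; apply: ge0_ler_powR; rewrite ?nnegrE ltW.
Qed.

Let series_neqNy (f : nat -> int) x :
  (\sum_(0 <= n <oo) (normc (x (f n)) `^ p)%:E != -oo)%E.
Proof.
rewrite gt_eqF// (lt_le_trans ltNy0)//.
by apply: nneseries_ge0 => n _ _; rewrite lee_fin powR_ge0.
Qed.

Lemma lp_pred_not_nondecreasing_right x : (forall n, 0 < normc (x n)) ->
  x \in lp_pred p ->
  ~ \forall n \near \oo, normc (x (Posz n)) <= normc (x (Posz n.+1)).
Proof.
move=> x0 + xle; rewrite inE/= lp_sum_int.
by rewrite nondecreasing_powR_nneseriesy// addye.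
Qed.

Lemma lp_pred_not_nondecreasing_left x : (forall n, 0 < normc (x n)) ->
  x \in lp_pred p ->
  ~ \forall n \near \oo, normc (x (Negz n)) <= normc (x (Negz n.+1)).
Proof.
move=> x0 + xle; rewrite inE/= lp_sum_int addeC.
by rewrite nondecreasing_powR_nneseriesy// addye.
Qed.

End two_sided_lp.

(** * Point spectrum of the forward shift *)

Section forward_shift_spectrum.
Context {R : realType} {p : R} {p1 : 1 <= p} {w : int -> R}.
Hypotheses (w_bounded : bounded_fun w) (w_gt0 : forall n, 0 < w n).
Context {wp wm : R}.
Hypotheses (cvg_wp : (fun n : nat => w n%:Z) @ \oo --> wp)
           (cvg_wm : (fun n : nat => w (- n%:Z)) @ \oo --> wm).
Local Notation V := (lpZ p1).
Local Notation F := (forward_shift p1 w_bounded).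

Lemma forward_shift_eigenP (l : R[i]) (x : V) :
  F x = l *: x <-> forall n, (w n)%:C * x n = l * x (n + 1).
Proof.
split=> [/lpZ_eqP Fx n|Fx]; first by have := Fx (n + 1); rewrite /= addrK.
by apply/lpZ_eqP => n; rewrite lpZ_scaleE /= Fx subrK.
Qed.

Let normc_gt0 (z : R[i]) : z != 0 -> 0 < normc z.
Proof.
by move=> z0; rewrite lt0r normc_ge0 andbT; apply: contra_neq z0; exact: eq0_normc.
Qed.

Let normc_weight n : normc (w n)%:C = w n.
Proof. by rewrite normc_real// ltW. Qed.

Let wC_neq0 n : (w n)%:C != 0.
Proof. by rewrite eq_complex/= eqxx andbT gt_eqF. Qed.

(** The recurrence propagates a zero of [x] in both directions: to the right since
    [l] is nonzero, to the left since the weights are. *)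
Lemma forward_shift_eigen_neq0 (l : R[i]) (x : V) : x != 0 -> F x = l *: x ->
  l != 0 /\ forall n, x n != 0.
Proof.
move=> x0 /forward_shift_eigenP Fx.
have l0 : l != 0.
  apply: contra_neq x0 => l0; apply/lpZ_eqP => n; rewrite lpZ_0E.
  by have := Fx n; rewrite l0 mul0r => /eqP; rewrite mulf_eq0 (negPf (wC_neq0 _)) => /eqP.
split=> // n; apply: contra_neq x0 => xn0.
have step m : (x (m + 1) == 0) = (x m == 0).
  have /(congr1 (fun z => z == 0)) := Fx m.
  by rewrite !mulf_eq0 (negPf (wC_neq0 _)) (negPf l0).
have x0E m : (x m == 0) = (x 0 == 0).
  elim/int_ind: m => // m <-; first by rewrite -addn1 PoszD step.
  by rewrite -step; congr (x _ == 0); lia.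
by apply/lpZ_eqP => m; apply/eqP; rewrite x0E -(x0E n) xn0.
Qed.

(** A failure of either inequality makes the moduli of an eigenvector eventually
    nondecreasing on a half-line: [|l| < wp] on the right one, [wm < |l|] on the
    left one. *)
Lemma point_spectrum_forward_shift_le (l : R[i]) :
  point_spectrum F l -> wp <= normc l <= wm.
Proof.
move=> /point_spectrumP[x x0 Fx].
have [l0 xn0] := forward_shift_eigen_neq0 l x x0 Fx.
have {xn0} xn0 n : 0 < normc (x n) by exact: normc_gt0.
have {l0} l0 : 0 < normc l by exact: normc_gt0.
have normFx n : w n * normc (x n) = normc l * normc (x (n + 1)).
  by rewrite -{1}normc_weight -!normcM; congr normc; move: n; apply/forward_shift_eigenP.
rewrite !leNgt; apply/andP; split; apply/negP => lw.
- apply: (lp_pred_not_nondecreasing_right p1 x xn0 (lp_funP x)).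
  have near_w : \forall n \near \oo, normc l <= w (Posz n) by exact: (cvgr_ge wp cvg_wp).
  apply: filterS near_w => n lwn.
  rewrite -(ler_pM2l l0) -[n.+1]addn1 PoszD -normFx.
  by rewrite ler_wpM2r// ltW.
- apply: (lp_pred_not_nondecreasing_left p1 x xn0 (lp_funP x)).
  have near_w : \forall n \near \oo, w (- n%:Z) <= normc l by exact: (cvgr_le wm cvg_wm).
  (* The ratio of the terms of indices Negz n.+1 and Negz n involves the weight
     at Negz n.+1 = - n.+2, hence the double shift. *)
  apply: filterS (near_infty_succ _ (near_infty_succ _ near_w)) => n lwn.
  have := normFx (Negz n.+1); have -> : Negz n.+1 + 1 = Negz n by lia.
  move=> E; rewrite -(ler_pM2l l0) -E.
  by rewrite ler_wpM2r// ltW.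
Qed.

(** The solution of the recurrence normalized by the value 1 at index 0. *)
Definition forward_eigenvector (l : R[i]) (n : int) : R[i] :=
  match n with
  | Posz n => \prod_(i < n) ((w i)%:C / l)
  | Negz n => \prod_(i < n.+1) (l / (w (Negz i))%:C)
  end.

Lemma forward_eigenvectorP (l : R[i]) (n : int) : l != 0 ->
  (w n)%:C * forward_eigenvector l n = l * forward_eigenvector l (n + 1).
Proof.
move=> l0; case: n => [n|[|n]].
- by rewrite -PoszD addn1 /= [in RHS]big_ord_recr/= [RHS]mulrCA [X in _ = _ * X]mulrCA divff// mulr1 mulrC.
- by rewrite /= big_ord_recr !big_ord0/= mul1r mulr1 mulrCA divff// mulr1.
have -> : Negz n.+1 + 1 = Negz n by lia.
by rewrite /= [in LHS]big_ord_recr/= [LHS]mulrCA [X in _ * X = _]mulrCA divff// mulr1 mulrC.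
Qed.

(** The strict inequalities leave room for bounds below 1 on the ratios of
    consecutive terms of the candidate, on both half-lines. *)
Lemma point_spectrum_forward_shift_gt (l : R[i]) :
  wp < normc l < wm -> point_spectrum F l.
Proof.
move=> /andP[wpl lwm].
have wp0 : 0 <= wp.
  by apply: (cvgr_to_ge cvg_wp); apply: nearW => n; exact: ltW.
have a0 : 0 < normc l by exact: le_lt_trans wp0 wpl.
have l0 : l != 0 by apply: contraTneq a0 => ->; rewrite normc0 ltxx.
set a := normc l in wpl lwm a0.
pose x := forward_eigenvector l.
have normx n : w n * normc (x n) = a * normc (x (n + 1)).
  by rewrite -{1}normc_weight -!normcM; congr normc; exact: forward_eigenvectorP.
(* Eventually w n <= u on the right and v <= w n on the left, which bounds the
   ratios by u / a < 1 and a / v < 1. *)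
pose u := (wp + a) / 2; pose v := (a + wm) / 2.
have [wpu ua] : wp < u /\ u < a by rewrite !midf_lt.
have [av vwm] : a < v /\ v < wm by rewrite !midf_lt.
have u0 : 0 < u by exact: le_lt_trans wpu.
have v0 : 0 < v by exact: lt_trans av.
have xlp : x \in lp_pred p.
  apply: (lp_pred_ratio p1 x (u / a) (a / v)).
  - by rewrite ltr_pdivrMr// mul1r.
  - by rewrite ltr_pdivrMr// mul1r.
  - by rewrite divr_ge0// ltW.
  - by rewrite divr_ge0// ltW.
  - have near_w : \forall n \near \oo, w (Posz n) <= u by exact: (cvgr_le wp cvg_wp).
    apply: filterS near_w => n wu.
    rewrite mulrAC ler_pdivlMr// mulrC -[n.+1]addn1 PoszD -normx.
    by rewrite ler_wpM2r// normc_ge0.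
  - have near_w : \forall n \near \oo, v <= w (- n%:Z) by exact: (cvgr_ge wm cvg_wm).
    apply: filterS (near_infty_succ _ (near_infty_succ _ near_w)) => n vw.
    have := normx (Negz n.+1); have -> : Negz n.+1 + 1 = Negz n by lia.
    rewrite mulrAC ler_pdivlMr// => <-.
    by rewrite mulrC ler_wpM2r// normc_ge0.
apply/point_spectrumP; exists (LpZ p1 xlp).
  apply/eqP => /lpZ_eqP/(_ 0); rewrite lpZ_0E /= big_ord0 => /eqP.
  by rewrite oner_eq0.
by apply/forward_shift_eigenP => n; exact: forward_eigenvectorP.
Qed.

End forward_shift_spectrum.

(** * Reflection of the index set *)

Lemma bounded_fun_reflect (R : realType) (w : int -> R) :
  bounded_fun w -> bounded_fun (fun n => w (- n)).
Proof.
case=> M [Mreal Mw]; exists M; split=> // r Mr n _.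
exact: Mw.
Qed.

(** The involution [x |-> (fun n => x (- n))] intertwines the two operators, so it
    exchanges their eigenvectors. *)
Lemma point_spectrum_backward_shift (R : realType) (p : R) (p1 : 1 <= p)
    (w : int -> R) (wb : bounded_fun w) (wb' : bounded_fun (fun n => w (- n))) :
  point_spectrum (backward_shift p1 wb) = point_spectrum (forward_shift p1 wb').
Proof.
have opp_bij : bijective (fun n : int => - n).
  by exists (fun n => - n) => n; rewrite opprK.
have reflectP (x : lpZ p1) : (fun n => x (- n)) \in lp_pred p.
  apply: (lp_normM p1 ler01 _ opp_bij (lp_funP x)).1 => n.
  by rewrite mul1r.
pose J x : lpZ p1 := LpZ p1 (reflectP x).
have J0 x : x != 0 -> J x != 0.
  apply: contra_neq => /lpZ_eqP Jx0; apply/lpZ_eqP => n.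
  by have := Jx0 (- n); rewrite /= opprK.
apply/seteqP; split=> l /point_spectrumP[x x0 /lpZ_eqP Tx];
  apply/point_spectrumP; exists (J x); rewrite ?J0//; apply/lpZ_eqP => n;
  by have := Tx (- n); rewrite lpZ_scaleE /= ?opprB ?opprD ?opprK// addrC.
Qed.

(** * Point spectra of the two shifts *)

Theorem proposition3p2p1 (R : realType) (p : R) (p1 : 1 <= p)
    (w : int -> R) (w_bounded : bounded_fun w) (w_gt0 : forall n, 0 < w n)
    (wp wm : R)
    (cvg_wp : (fun n : nat => w n%:Z) @ \oo --> wp)
    (cvg_wm : (fun n : nat => w (- n%:Z)) @ \oo --> wm) :
  [/\ wp <= wm ->
        [set l : R[i] | wp%:C < `|l| < wm%:C] `<=` point_spectrum (forward_shift p1 w_bounded) /\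
        point_spectrum (forward_shift p1 w_bounded) `<=` [set l : R[i] | wp%:C <= `|l| <= wm%:C],
      wm < wp -> point_spectrum (forward_shift p1 w_bounded) = set0,
      wm <= wp ->
        [set l : R[i] | wm%:C < `|l| < wp%:C] `<=` point_spectrum (backward_shift p1 w_bounded) /\
        point_spectrum (backward_shift p1 w_bounded) `<=` [set l : R[i] | wm%:C <= `|l| <= wp%:C]
    & wp < wm -> point_spectrum (backward_shift p1 w_bounded) = set0].
Proof.
have normE (l : R[i]) : `|l| = (normc l)%:C by [].
have forward (v : int -> R) (vb : bounded_fun v) (vp vm : R) :
    (forall n, 0 < v n) ->
    (fun n : nat => v n%:Z) @ \oo --> vp ->
    (fun n : nat => v (- n%:Z)) @ \oo --> vm ->
    ([set l : R[i] | vp%:C < `|l| < vm%:C] `<=` point_spectrum (forward_shift p1 vb) /\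
     point_spectrum (forward_shift p1 vb) `<=` [set l : R[i] | vp%:C <= `|l| <= vm%:C]) /\
    (vm < vp -> point_spectrum (forward_shift p1 vb) = set0).
  move=> v0 vvp vvm.
  have outer := point_spectrum_forward_shift_le vb v0 vvp vvm.
  split; first split=> l /=; rewrite ?normE ?ltcR ?lecR.
  - exact: point_spectrum_forward_shift_gt.
  - exact: outer.
  move=> vmp; rewrite -subset0 => l /outer/andP[vpl lvm].
  by have := lt_le_trans vmp (le_trans vpl lvm); rewrite ltxx.
have [Fring Fempty] := forward w w_bounded wp wm w_gt0 cvg_wp cvg_wm.
have wb' := bounded_fun_reflect _ _ w_bounded.
have cvg_wp' : (fun n : nat => w (- - n%:Z)) @ \oo --> wp.
  by under eq_fun do rewrite opprK.
have [Bring Bempty] := forward _ wb' wm wp (fun n => w_gt0 (- n)) cvg_wm cvg_wp'.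
by rewrite (point_spectrum_backward_shift _ _ _ _ w_bounded wb').
Qed.
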